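(* Let $G$ be a $4$-regular graph on $n$ vertices, and let $s=\lceil (n+4)/5\rceil$. Then $\operatorname{tvs}(G)=s$. Moreover, $G$ has a vertex irregular total $s$-labeling whose set of vertex weights is exactly $\{5,6,\ldots,n+4\}$.
   Context: All graphs are finite and simple, and need not be connected. For a positive integer $k$, a total $k$-labeling of a graph $G$ is a mapping $\lambda:V(G)\cup E(G)\to\{1,\ldots,k\}$. The weight of a vertex $v$ under $\lambda$ is $\operatorname{wt}_\lambda(v)=\lambda(v)+\sum_{e\ni v}\lambda(e)$, the sum being over the edges $e$ of $G$ incident with $v$. The labeling $\lambda$ is vertex irregular if $\operatorname{wt}_\lambda(u)\ne\operatorname{wt}_\lambda(v)$ for any two distinct vertices $u,v\in V(G)$. The total vertex irregularity strength $\operatorname{tvs}(G)$ is the smallest positive integer $k$ for which $G$ has a vertex irregular total $k$-labeling. *)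

(* Defs.v *)
From HB Require Import structures.
From mathcomp Require Import all_boot.

Set Implicit Arguments.
Unset Strict Implicit.
Unset Printing Implicit Defensive.

Record sgraph := SGraph {
  vertex :> finType;
  adj : rel vertex;
  adj_sym : symmetric adj;
  adj_irr : irreflexive adj
}.

Definition edges (G : sgraph) : {set {set G}} :=
  [set A | [exists x, exists y, adj x y && (A == [set x; y])]].

Definition edge (G : sgraph) : finType := {A : {set G} | A \in edges G}.

Definition degree (G : sgraph) (v : G) : nat := #|[set w | adj v w]|.

Definition regular (d : nat) (G : sgraph) : Prop := forall v : G, degree v = d.

(* Labels live in the finite type {0, ..., k}; total_labeling excludes 0. *)
Definition labeling (k : nat) (G : sgraph) : finType :=
  {ffun G + edge G -> 'I_k.+1}.

Definition total_labeling (k : nat) (G : sgraph) (lam : labeling k G) : bool :=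
  [forall x, 1 <= lam x <= k].

Definition wt (k : nat) (G : sgraph) (lam : labeling k G) (v : G) : nat :=
  lam (inl v) + \sum_(A : edge G | v \in val A) lam (inr A).

Definition vertex_irregular (k : nat) (G : sgraph) (lam : labeling k G) : bool :=
  [forall u, forall v, (u != v) ==> (wt lam u != wt lam v)].

Definition has_irregular_total_labeling (G : sgraph) (k : nat) : bool :=
  [exists lam : labeling k G, total_labeling lam && vertex_irregular lam].

(* Give every edge the label 1 and choose the vertex labels so that the weights
   are #|E| + 1, ..., #|E| + #|V|; one more keeps k positive. *)
Lemma tvs_exists (G : sgraph) :
  exists k, (0 < k) && has_irregular_total_labeling G k.
Proof.
pose m := #|{: edge G}|; pose d (v : G) := #|[pred A : edge G | v \in val A]|.
have le_dm v : d v <= m by apply: max_card.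
exists (#|G| + m).+1; rewrite ltn0Sn /=; apply/existsP.
pose f (x : G + edge G) : nat :=
  if x is inl v then (enum_rank v).+1 + (m - d v) else 1.
have f_ok x : 1 <= f x <= (#|G| + m).+1.
  case: x => [v|A] /=; last by [].
  rewrite addSn !ltnS /=.
  by apply: leq_add; [apply/ltnW/ltn_ord | apply: leq_subr].
pose lam : labeling (#|G| + m).+1 G := [ffun x => inord (f x)].
have lamE x : lam x = f x :> nat.
  by rewrite ffunE inordK // ltnS; case/andP: (f_ok x).
have wtE v : wt lam v = (enum_rank v).+1 + m.
  rewrite /wt lamE /= (eq_bigr (fun=> 1)); last by move=> A _; rewrite lamE.
  by rewrite sum1_card -addnA subnK //; apply: le_dm.
exists lam; apply/andP; split; first by apply/forallP => x; rewrite lamE f_ok.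
apply/forallP => u; apply/forallP => v; apply/implyP; apply: contraNN.
rewrite !wtE eqn_add2r eqSS => /eqP/val_inj/enum_rank_inj -> //.
Qed.

Definition tvs (G : sgraph) : nat := ex_minn (tvs_exists G).

Definition ceil_div (m d : nat) : nat := (m + d.-1) %/ d.

Lemma ceil_div_le (m d k : nat) : 0 < d -> (ceil_div m d <= k) = (m <= k * d).
Proof.
case: d => // d _; rewrite /ceil_div /= -ltnS ltn_divLR // mulSn.
by rewrite addnC addSn ltnS leq_add2l.
Qed.

(* Main.v *)
Require Import Defs.
From mathcomp Require Import all_boot perm zify.

(** Lower all labels by 1 and put k = s - 1. If edge labels in {0, ..., k} produce
vertex sums sigma such that j + 1 <= #{v | sigma v <= j} <= j + 1 + k for all j < n,
then the t-th vertex in the order of sigma satisfies t - k <= sigma <= t, and the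
vertex label t - sigma gives it the weight t; so it suffices to find such edge labels.

By Petersen's theorem the edges are the arcs v -> p v and v -> q v of two
permutations. Split the vertices into a red set of size 3k + 1 and a blue set B that
p leaves at most once. An arc of p gets the label k if both its ends are blue and 0
otherwise, up to a correction on the two arcs crossing between the colours; an arc of q
gets the label 0 if its tail lies in a set W and k otherwise. Up to the correction,
sigma is then k times the number of arcs with label k at v, and W has to be chosen so
that about k red vertices lie on two, and k red and k blue ones on exactly one, of the
arcs of q with tail in W. If many arcs of q enter B after two red vertices, W consists
of the tails of k such paths of length 2. Otherwise W starts from the red vertices without
most of the exits into B, is shrunk one vertex at a time while at most one or two
of its arcs leave it for red vertices, and is completed by pairwise disjoint arcs of q. *)

Set Implicit Arguments.
Unset Strict Implicit.
Unset Printing Implicit Defensive.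

(** * From vertex sums to labelings *)

Lemma big_edges (G : sgraph) (F : {set G} -> nat) (v : G) :
  \sum_(A : edge G | v \in val A) F (val A) = \sum_(w | adj v w) F [set v; w].
Proof.
have -> : \sum_(A : edge G | v \in val A) F (val A) =
          \sum_(A in edges G | v \in A) F A.
  rewrite [RHS](reindex_omap (val : edge G -> _) insub); last first.
    by move=> A /andP[AE _]; rewrite insubT.
  by apply: eq_bigl => A; rewrite (valP A) valK eqxx andbT.
transitivity (\sum_(A in [set [set v; w] | w in [set w | adj v w]]) F A).
  apply: eq_bigl => A; apply/andP/imsetP => [[]|[w]].
    rewrite inE => /existsP[x /existsP[y /andP[xy /eqP ->]]].
    rewrite !inE => /orP[]/eqP ->; first by exists y; rewrite ?inE.
    by exists x; rewrite ?inE 1?adj_sym // setUC.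
  rewrite inE => vw ->; rewrite !inE eqxx; split=> //.
  by apply/existsP; exists v; apply/existsP; exists w; rewrite vw eqxx.
rewrite big_imset /=; first by apply: eq_bigl => w; rewrite inE.
move=> w w'; rewrite !inE => vw vw' /setP eqA.
have := eqA w; rewrite !inE eqxx orbT => /esym/orP[]/eqP // wv.
by rewrite wv adj_irr in vw.
Qed.

(** Sort by [sg], ties broken by [enum_rank], and let [t v] count the predecessors of [v]. If
    [sg v = j + 1], the at least [j + 1] elements of value at most [j] all precede [v]; conversely,
    [v] and its predecessors all have value at most [sg v]. *)
Lemma rank_of_band (T : finType) (sg : T -> nat) (k : nat) :
  (forall j, j < #|T| -> j < #|[set v | sg v <= j]| <= j.+1 + k) ->
  exists t : T -> 'I_#|T|,
    injective t /\ forall v, sg v <= t v <= sg v + k.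
Proof.
move=> band; pose e v := sg v * #|T| + enum_rank v.
have lt_e u v : sg u < sg v -> e u < e v.
  move=> suv; apply: leq_trans (leq_addr _ _).
  apply: (@leq_trans ((sg u).+1 * #|T|)); last by rewrite leq_mul2r suv orbT.
  by rewrite /e mulSn addnC ltn_add2r ltn_ord.
have le_e u v : e u < e v -> sg u <= sg v.
  by apply: contraTleq => /lt_e /ltnW; rewrite -leqNgt.
have e_inj : injective e.
  move=> u v euv.
  have suv : sg u = sg v.
    by have [/lt_e|/lt_e|//] := ltngtP (sg u) (sg v); rewrite euv ltnn.
  by move: euv; rewrite /e suv => /addnI/val_inj/enum_rank_inj.
pose r v := #|[set u | e u < e v]|.
have r_lt v : r v < #|T|.
  rewrite -cardsT; apply: proper_card; rewrite properE subsetT /=.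
  by apply/subsetPn; exists v; rewrite !inE // ltnn.
have r_mono u v : e u < e v -> r u < r v.
  move=> euv; apply: proper_card; rewrite properE; apply/andP; split.
    by apply/subsetP => w; rewrite !inE => wu; apply: ltn_trans euv.
  by apply/subsetPn; exists u; rewrite !inE ?ltnn.
(* At [j = #|T| - 1] the lower bound already exhausts [T]; hence the band may be used at
   [j = sg v]. *)
have sg_lt v : sg v < #|T|.
  have T0 : 0 < #|T| by apply/card_gt0P; exists v.
  have := band #|T|.-1; rewrite prednK // leqnn => /(_ isT)/andP[T1 _].
  have /eqP/setP/(_ v) : [set v | sg v <= #|T|.-1] == setT.
    by rewrite eqEcard subsetT cardsT.
  by rewrite !inE; lia.
exists (fun v => Ordinal (r_lt v)); split=> [u v [ruv]|v /=].
  apply: e_inj.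
  by have [/r_mono|/r_mono|//] := ltngtP (e u) (e v); rewrite ruv ltnn.
have /andP[_ up] := band _ (sg_lt v); apply/andP; split.
  case sv: (sg v) => [//|j]; have := sg_lt v; rewrite sv => /ltnW/band/andP[lo _].
  apply: leq_trans lo _; apply: subset_leq_card; apply/subsetP => u.
  by rewrite !inE -ltnS -sv; apply: lt_e.
suff: r v < #|[set u | sg u <= sg v]| by lia.
apply: proper_card; rewrite properE; apply/andP; split.
  by apply/subsetP => u; rewrite !inE; apply: le_e.
by apply/subsetPn; exists v; rewrite !inE ?ltnn ?leqnn.
Qed.

Lemma labeling_of_band (G : sgraph) (k : nat) (y : G -> G -> nat) :
    regular 4 G -> (forall u v, y u v = y v u) -> (forall u v, y u v <= k) ->
    (forall j, j < #|G| ->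
       j < #|[set v | \sum_(w | adj v w) y v w <= j]| <= j.+1 + k) ->
  exists lam : labeling k.+1 G,
    [/\ total_labeling lam, vertex_irregular lam &
        forall w : nat, (exists v : G, wt lam v = w) <-> 5 <= w <= #|G| + 4].
Proof.
move=> reg4 ysym yk /rank_of_band[t [t_inj tP]].
set sg := fun v => \sum_(w | adj v w) y v w in tP.
(* Since [y] is symmetric, it does not matter which ordered pair represents an edge; 0 is a default
   for sets that no pair represents. *)
pose F (A : {set G}) :=
  if [pick d : G * G | A == [set d.1; d.2]] is Some d then y d.1 d.2 else 0.
have FE u v : F [set u; v] = y u v.
  rewrite /F; case: pickP => [[a b] /= /eqP/setP eqA|/(_ (u, v))]; last by rewrite eqxx.
  have : (a \in [set u; v]) && (b \in [set u; v]) by rewrite !eqA !inE !eqxx orbT.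
  have := eqA v; have := eqA u; rewrite !inE !eqxx orbT /=.
  by move=> /esym/orP[]/eqP? /esym/orP[]/eqP? /andP[/orP[]/eqP? /orP[]/eqP?]; subst.
have Fk A : F A <= k by rewrite /F; case: pickP.
pose f (x : G + edge G) := match x with
  inl v => (t v - sg v).+1 | inr A => (F (val A)).+1 end.
have f_ok x : 0 < f x <= k.+1.
  by case: x => [v|A] /=; rewrite ltnS ?Fk // leq_subLR; case/andP: (tP v).
pose lam : labeling k.+1 G := [ffun x => inord (f x)].
have lamE x : lam x = f x :> nat.
  by rewrite ffunE inordK // ltnS; case/andP: (f_ok x).
(* The five unit shifts make up the 5, and [t v - sg v] fills the edge sum [sg v] up to [t v]. *)
have wtE v : wt lam v = t v + 5.
  rewrite /wt lamE /= (eq_bigr (fun A : edge G => (F (val A)).+1)); last first.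
    by move=> A _; rewrite lamE.
  rewrite (big_edges (fun A => (F A).+1)).
  rewrite (eq_bigr (fun w => 1 + y v w)); last by move=> w _; rewrite FE.
  rewrite big_split /= sum1_card.
  have -> : #|adj v| = 4 by rewrite -(reg4 v); apply: eq_card => w; rewrite !inE.
  move: (tP v); rewrite -/(sg v). move: (sg v) (nat_of_ord (t v)) => S r; lia.
exists lam; split; first by apply/forallP => x; rewrite lamE f_ok.
  apply/forallP => u; apply/forallP => v; apply/implyP; apply: contraNN.
  by rewrite !wtE eqn_add2r => /eqP/val_inj/t_inj ->.
move=> w; split=> [[v <-]|/andP[w5 wn]].
  by rewrite wtE; have := ltn_ord (t v); lia.
have wlt : w - 5 < #|G| by lia.
have /codomP[v tv] : Ordinal wlt \in codom t by apply: inj_card_onto; rewrite ?card_ord.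
by exists v; rewrite wtE -tv /=; lia.
Qed.

(** A weight is a sum of five labels, so it lies between 5 and [5 * k]; this leaves room for at most
    [5 * k - 4] distinct weights. *)
Lemma ceil_div_le_tvs (G : sgraph) :
  regular 4 G -> ceil_div (#|G| + 4) 5 <= tvs G.
Proof.
move=> reg4; rewrite ceil_div_le // /tvs; case: ex_minnP => k /andP[k0].
case/existsP => lam /andP[/forallP lam_ok /forallP lam_irr] _.
have deg4 v : \sum_(A : edge G | v \in val A) 1 = 4.
  rewrite (big_edges (fun=> 1)) sum1_card -(reg4 v).
  by apply: eq_card => w; rewrite !inE.
have wt5 v : 5 <= wt lam v.
  have : 4 <= \sum_(A : edge G | v \in val A) lam (inr A).
    rewrite -[X in X <= _](deg4 v); apply: leq_sum => A _.
    by case/andP: (lam_ok (inr A)).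
  by rewrite /wt; have := lam_ok (inl v); lia.
have wt_lt v : wt lam v - 5 < k * 5 - 4.
  have : \sum_(A : edge G | v \in val A) lam (inr A) <= 4 * k.
    rewrite -[4](deg4 v) big_distrl /=; apply: leq_sum => A _.
    by rewrite mul1n; case/andP: (lam_ok (inr A)).
  by have := wt5 v; rewrite /wt; have := lam_ok (inl v); lia.
have inj : injective (fun v => Ordinal (wt_lt v)).
  move=> u v [] wuv; apply/eqP; apply: contraT => uv.
  have /forallP/(_ v)/implyP/(_ uv) := lam_irr u.
  by have := wt5 u; have := wt5 v; lia.
by have := leq_card _ inj; rewrite card_ord; lia.
Qed.

(** * Decomposition into two permutations *)

(* Colour the orbits of [s \o t] so that [s] exchanges the two colours: by parity,
   [s x] never lies in the orbit of [x]. *)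
Lemma involutions_bipartite (T : finType) (s t : T -> T) (A : {set T}) :
    involutive s -> involutive t ->
    {in A, forall x, s x != x} -> {in A, forall x, t x != x} ->
    {in A, forall x, s x \in A} -> {in A, forall x, t x \in A} ->
  exists c : pred T,
    {in A, forall x, c (s x) = ~~ c x} /\ {in A, forall x, c (t x) = ~~ c x}.
Proof.
move=> sK tK s_fp t_fp sA tA; pose f x := s (t x).
have f_inj : injective f by apply: inj_comp; apply: can_inj; [apply: sK|apply: tK].
have fi_inj i : injective (iter i f).
  by elim: i => // i ih; apply: inj_comp.
have fA i x : x \in A -> iter i f x \in A.
  by move=> xA; elim: i => //= i ih; apply/sA/tA.
have fsf i x : iter i f (s (iter i f x)) = s x.
  elim: i => // i ih; rewrite iterSr iterS.
  by have -> y : f (s (f y)) = s y by rewrite /f sK tK.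
(* Let [s x] be the [i]-th iterate of [f] at [x] and [j = i./2]. As [s] conjugates [f] to its
   inverse, cancelling [f^j] shows that [f^j x] is fixed by [s] if [i] is even and by [t] if [i] is
   odd. *)
have s_orbit x : x \in A -> ~~ fconnect f x (s x).
  move=> xA; apply/negP => /iter_findex; move: (findex _ _ _) => i.
  rewrite -[i]odd_double_half -addnn; set j := i./2.
  have fj := fA j x xA; case: (odd i); rewrite ?add0n ?add1n.
    rewrite -addnS iterD -[in RHS](fsf j) => /(@fi_inj j).
    by rewrite iterS /f => /(can_inj sK)/eqP; apply/negP/t_fp.
  rewrite iterD -[in RHS](fsf j) => /(@fi_inj j)/esym/eqP.
  exact/negP/s_fp.
have csym : connect_sym (frel f) by apply: fconnect_sym.
pose rt x := froot f x; have rtE x y : (rt x == rt y) = fconnect f x y.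
  by rewrite /rt root_connect.
have rt_f x : rt (f x) = rt x.
  by apply/eqP; rewrite rtE csym fconnect1.
have rt_t x : rt (t x) = rt (s x) by rewrite -(rt_f (t x)) /f tK.
pose c x := enum_rank (rt x) < enum_rank (rt (s x)).
have cs x : x \in A -> c (s x) = ~~ c x.
  move=> xA; rewrite /c sK -leqNgt [RHS]leq_eqVlt orb_idl //.
  move=> /eqP/val_inj/enum_rank_inj/esym/eqP.
  by rewrite rtE (negPf (s_orbit x xA)).
exists c; split=> // x xA; rewrite -(cs x xA) /c sK rt_t.
by rewrite -/(f x) rt_f.
Qed.

(** The elements of a fibre in [A] are paired off along its enumeration, positions [2 i] and
    [2 i + 1] together; evenness leaves none over. Outside [A] the map is the identity. *)
Lemma fiber_involution (T : finType) (K : eqType) (A : {set T}) (key : T -> K) :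
    (forall a, ~~ odd #|[set x in A | key x == a]|) ->
  exists s : T -> T, [/\ involutive s, forall x, key (s x) = key x,
    {in A, forall x, s x != x} & {in A, forall x, s x \in A}].
Proof.
move=> even_fib; pose e x := enum [set y in A | key y == key x].
pose flip i := if odd i then i.-1 else i.+1.
have flipK i : flip (flip i) = i.
  by rewrite /flip; case oi: (odd i) => /=; rewrite ?oi //; case: i oi => //= i /negPf ->.
pose s x := if x \in A then nth x (e x) (flip (index x (e x))) else x.
have x_e x : x \in A -> x \in e x by move=> xA; rewrite mem_enum inE xA eqxx.
have lt_flip x : x \in A -> flip (index x (e x)) < size (e x).
  move=> xA; have := x_e x xA; rewrite -index_mem.
  have : ~~ odd (size (e x)) by rewrite /e -cardE.
  rewrite /flip; case: ifP => [_ _|oi]; first exact/leq_ltn_trans/leq_pred.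
  rewrite leq_eqVlt => ev /orP[/eqP sz|//].
  by move: ev; rewrite -sz /= oi.
have s_e x : x \in A -> s x \in e x.
  by move=> xA; rewrite /s xA mem_nth ?lt_flip.
have sA x : x \in A -> s x \in A.
  by move=> /s_e; rewrite mem_enum inE => /andP[].
have s_key x : key (s x) = key x.
  case: (boolP (x \in A)) => [/s_e|/negPf xA]; last by rewrite /s xA.
  by rewrite mem_enum inE => /andP[_ /eqP].
exists s; split=> // [x|x xA].
  case: (boolP (x \in A)) => xA; last by rewrite /s (negPf xA) (negPf xA).
  rewrite {1}/s sA //= /e s_key -/(e x).
  rewrite {2}/s xA index_uniq ?lt_flip ?enum_uniq // flipK.
  by rewrite (set_nth_default x) ?nth_index ?index_mem ?x_e.
apply/eqP => sx; have := index_uniq x (lt_flip x xA) (enum_uniq _).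
have -> : nth x (e x) (flip (index x (e x))) = x by move: sx; rewrite /s xA.
by rewrite /flip; case: (index x _) => [|i] //=; case: odd => /=; lia.
Qed.

(** [s] exchanges the coloured and the uncoloured elements of the fibre. *)
Lemma half_fiber (T : finType) (K : eqType) (A : {set T}) (key : T -> K)
    (s : T -> T) (c : pred T) (a : K) :
    involutive s -> (forall x, key (s x) = key x) -> {in A, forall x, s x \in A} ->
    {in A, forall x, c (s x) = ~~ c x} ->
  #|[set x in A | key x == a & c x]|.*2 = #|[set x in A | key x == a]|.
Proof.
move=> sK s_key sA cs.
rewrite -addnn -(cardsID [set x | c x] [set x in A | key x == a]).
have sAE x : (s x \in A) = (x \in A).
  by apply/idP/idP => [/sA|/sA //]; rewrite sK.
congr (_ + _); first by apply: eq_card => x; rewrite !inE andbA.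
rewrite -(card_imset _ (can_inj sK)); apply: eq_card => x.
rewrite -[x]sK mem_imset; last exact: can_inj sK.
rewrite !inE s_key !sAE sK; have [xA|] := boolP (x \in A); last by rewrite andbF.
by rewrite cs //= andbC.
Qed.

Lemma perm_of_rel (T : finType) (S : {set T * T}) :
    (forall v, #|[set d in S | d.1 == v]| = 1) ->
    (forall v, #|[set d in S | d.2 == v]| = 1) ->
  exists p : {perm T}, forall v w, ((v, w) \in S) = (w == p v).
Proof.
move=> out1 in1.
have /fin_all_exists[f fE] v : exists w, forall w', ((v, w') \in S) = (w' == w).
  have /eqP/cards1P[[v' w] /setP Ev] := out1 v; exists w => w'.
  have := Ev (v, w'); have := Ev (v', w); rewrite !inE /= !eqxx andbT.
  by move=> /andP[_ /eqP ->]; rewrite xpair_eqE eqxx.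
have f_inj : injective f.
  move=> u v fuv; have /eqP/cards1P[d /setP Ed] := in1 (f v).
  have := Ed (u, f v); have := Ed (v, f v).
  by rewrite !inE !fE fuv !eqxx => /esym/eqP <- /esym/eqP[].
by exists (perm f_inj) => v w; rewrite permE fE.
Qed.

(* Petersen: orient every edge so that all in- and out-degrees are 2, then split the
   arcs into two sets in which all in- and out-degrees are 1. *)
Lemma two_factorization (G : sgraph) : regular 4 G ->
  exists p q : {perm G}, forall v,
    uniq [:: p v; p^-1 v; q v; q^-1 v]%g /\
    forall w, adj v w = (w \in [:: p v; p^-1 v; q v; q^-1 v]%g).
Proof.
move=> reg4; pose A := [set d : G * G | adj d.1 d.2].
pose sw (d : G * G) := (d.2, d.1).
have swK : involutive sw by case.
have A4 v : #|[set d in A | d.1 == v]| = 4.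
  have pairI : injective (pair v : G -> G * G) by move=> x y [].
  rewrite -(reg4 v) /degree -(card_imset _ pairI).
  apply: eq_card => -[u w]; rewrite !inE /=; apply/andP/imsetP => [[uw /eqP uv]|[x]].
    by exists w; rewrite ?inE -uv.
  by rewrite inE => vx [-> ->].
have /fiber_involution[t [tK t_key t_fp tA]] : forall v, ~~ odd #|[set d in A | d.1 == v]|.
  by move=> v; rewrite A4.
have swA : {in A, forall d, sw d \in A} by move=> d; rewrite !inE adj_sym.
(* Exactly one of an arc and its reverse has colour [c], so [c] is an orientation; [t] pairs arcs
   with a common tail, so two of the four arcs at a vertex point outwards. *)
have [|c [c_sw c_t]] := involutions_bipartite swK tK _ t_fp swA tA.
  by move=> [u w]; rewrite inE /sw xpair_eqE /=; apply: contraL => /andP[/eqP->]; rewrite adj_irr.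
pose A' := [set d in A | c d].
have swA' u w : adj u w -> ((w, u) \in A') = ((u, w) \notin A').
  move=> uw; have dA : (u, w) \in A by rewrite inE.
  by rewrite !inE /= (adj_sym w) uw; apply: (c_sw _ dA).
have out2 v : #|[set d in A' | d.1 == v]| = 2.
  apply: double_inj; rewrite -[RHS](A4 v) -(half_fiber v tK t_key tA c_t).
  by congr (_.*2); apply: eq_card => d; rewrite !inE -andbA [c d && _]andbC.
have in2 v : #|[set d in A' | d.2 == v]| = 2.
  (* The arcs of [A'] entering [v] are the reverses of the arcs leaving [v] without colour [c]. *)
  have c_t' : {in A, forall x, ~~ c (t x) = ~~ ~~ c x} by move=> x /c_t ->.
  apply: double_inj; rewrite -[RHS](A4 v) -(half_fiber v tK t_key tA c_t').
  congr (_.*2); rewrite -(card_imset _ (can_inj swK)); apply: eq_card => d.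
  rewrite -[d in LHS]swK mem_imset; last exact: can_inj swK.
  case: d => u w; rewrite !inE /= (adj_sym w).
  have [uw|//] := boolP (adj u w); have := c_sw (u, w); rewrite inE uw => /(_ isT).
  by rewrite /sw /= => ->; rewrite andbC.
have /fiber_involution[s1 [s1K s1_key s1_fp s1A]] : forall v, ~~ odd #|[set d in A' | d.1 == v]|.
  by move=> v; rewrite out2.
have /fiber_involution[s2 [s2K s2_key s2_fp s2A]] : forall v, ~~ odd #|[set d in A' | d.2 == v]|.
  by move=> v; rewrite in2.
(* [b] separates the two arcs of [A'] leaving a vertex, and also the two entering it, so each colour
   class is the graph of a permutation. *)
have [b [b1 b2]] := involutions_bipartite s1K s2K s1_fp s2_fp s1A s2A.
have b1' : {in A', forall x, ~~ b (s1 x) = ~~ ~~ b x} by move=> x /b1 ->.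
have b2' : {in A', forall x, ~~ b (s2 x) = ~~ ~~ b x} by move=> x /b2 ->.
have [||p pE] := @perm_of_rel G [set d in A' | b d].
- move=> v; apply: double_inj; rewrite -[RHS](out2 v) -(half_fiber v s1K s1_key s1A b1).
  by congr (_.*2); apply: eq_card => d; rewrite !inE -!andbA [b d && _]andbC.
- move=> v; apply: double_inj; rewrite -[RHS](in2 v) -(half_fiber v s2K s2_key s2A b2).
  by congr (_.*2); apply: eq_card => d; rewrite !inE -!andbA [b d && _]andbC.
have [||q qE] := @perm_of_rel G [set d in A' | ~~ b d].
- move=> v; apply: double_inj; rewrite -[RHS](out2 v) -(half_fiber v s1K s1_key s1A b1').
  by congr (_.*2); apply: eq_card => d; rewrite !inE -!andbA [~~ b d && _]andbC.
- move=> v; apply: double_inj; rewrite -[RHS](in2 v) -(half_fiber v s2K s2_key s2A b2').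
  by congr (_.*2); apply: eq_card => d; rewrite !inE -!andbA [~~ b d && _]andbC.
have A'E v w : ((v, w) \in A') = (w == p v) || (w == q v).
  by rewrite -pE -qE !inE /=; case: adj; case: (c _); case: (b _).
have pq v : p v != q v.
  apply/eqP => pqv; have := pE v (p v); have := qE v (p v).
  by rewrite !inE pqv !eqxx => /andP[_ /negPf ->]; rewrite andbF.
have A'adj v w : (v, w) \in A' -> adj v w by rewrite !inE => /andP[].
have adjE v w : adj v w = ((v, w) \in A') || ((w, v) \in A').
  apply/idP/orP => [vw|[/A'adj //|/A'adj]]; last by rewrite adj_sym.
  by rewrite (swA' _ _ vw); case: (_ \in _); [left|right].
have excl v w : (v, w) \in A' -> (w, v) \in A' -> False.
  by move=> vw; rewrite (swA' _ _ (A'adj _ _ vw)) vw.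
have permV (r : {perm G}) v w : (v == r w) = (w == r^-1 v)%g.
  by apply/eqP/eqP => ->; rewrite ?permK ?permKV.
exists p, q => v; split; last first.
  move=> w; rewrite adjE !A'E !inE !(permV _ v).
  by rewrite -!orbA; congr (_ || _); rewrite orbCA.
have ne (r r' : {perm G}) : (forall u, (u, r u) \in A') -> (forall u, (u, r' u) \in A') ->
    r v != (r'^-1 v)%g.
  move=> rA r'A; apply/eqP => rr'; have := r'A (r v).
  by rewrite {2}rr' permKV; apply: (excl _ _ (rA v)).
have pA u : (u, p u) \in A' by rewrite A'E eqxx.
have qA u : (u, q u) \in A' by rewrite A'E eqxx orbT.
have pqV : (p^-1 v != q^-1 v)%g.
  by apply/eqP => e; have := pq (p^-1 v)%g; rewrite {2}e !permKV eqxx.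
rewrite /= !inE !negb_or (ne p p) // (ne p q) // pq (ne q q) // pqV.
by rewrite eq_sym (ne q p).
Qed.

(** * Choice of the arcs of the second permutation *)

Lemma mem_perm_imset (T : finType) (q : {perm T}) (W : {set T}) v :
  (v \in q @: W) = (q^-1%g v \in W).
Proof. by rewrite -{1}[v](permKV q) mem_imset //; apply: perm_inj. Qed.

(** Greedy choice: [x] chosen arcs block only their tails and the images and preimages of these, at
    most [3 * x] tails. One more arc is thus available once there are more than [3 * x], whence the
    [+ 2]. *)
Lemma disjoint_arcs (T : finType) (q : {perm T}) (U : {set T}) (x : nat) :
    (forall v, q v != v) -> 3 * x <= #|[set v in U | q v \in U]| + 2 ->
  exists A : {set T}, [/\ A \subset U, q @: A \subset U, [disjoint A & q @: A] & #|A| = x].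
Proof.
move=> q_fp; elim: x => [|x IH] arcs.
  by exists set0; rewrite imset0 !sub0set cards0 disjoints_subset sub0set.
have [|A [AU qAU dA cA]] := IH; first by lia.
pose F := A :|: q @: A :|: q^-1%g @: A.
have F_le : #|F| <= 3 * x.
  have [+ _] := leq_card_setU (A :|: q @: A) (q^-1%g @: A).
  have [+ _] := leq_card_setU A (q @: A).
  by rewrite !card_imset ?cA; [rewrite /F; lia|exact: perm_inj..].
have [v /andP[]] : exists v, (v \in [set v in U | q v \in U]) && (v \notin F).
  apply/existsP; apply: contraLR arcs => /existsPn sub.
  have /subset_leq_card : [set v in U | q v \in U] \subset F.
    by apply/subsetP => v vU; have := sub v; rewrite vU negbK.
  by lia.
rewrite !inE => /andP[vU qvU]; rewrite !mem_perm_imset invgK !negb_or => /andP[/andP[vA vqA] qvA].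
exists (v |: A); split.
- by rewrite subUset sub1set vU.
- by rewrite imsetU1 subUset sub1set qvU.
- rewrite -setI_eq0; apply/eqP/setP => u; rewrite imsetU1 !inE.
  apply/negP => /andP[/orP[/eqP->|uA] /orP[]].
  + by rewrite eq_sym; apply/negP.
  + by rewrite mem_perm_imset; apply/negP.
  + by move=> /eqP uv; rewrite -uv uA in qvA.
  by move=> uqA; have /disjointFr/(_ uA) := dA; rewrite uqA.
by rewrite cardsU1 vA cA.
Qed.

(** Delete vertices outside [Th] one by one. Deleting [b] makes at most one new arc leave the set,
    the one into [b]. If some arc leaves already, let [b] be the tail of such an arc, so that the
    count does not grow; otherwise it becomes at most 1. *)
Lemma peel (T : finType) (q : {perm T}) (Th X : {set T}) (E t : nat) :
    Th \subset X -> 0 < E -> #|[set v in X :\: Th | q v \notin X]| <= E ->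
    #|Th| <= t <= #|X| ->
  exists W : {set T}, [/\ Th \subset W, W \subset X, #|W| = t &
    #|[set v in W :\: Th | q v \notin W]| <= E].
Proof.
move=> ThX E0; have [m] := ubnP #|X|; elim: m X ThX => // m IH X ThX mX eX /andP[Tht tX].
have [tXe|tX1] := eqVneq #|X| t; first by exists X.
have tlt : t < #|X| by rewrite ltn_neqAle eq_sym tX1.
pose N := [set v in X :\: Th | q v \notin X].
have [b bX bN] : exists2 b, b \in X :\: Th & (b \in N) || (N == set0).
  have [N0|/set0Pn[b bN]] := eqVneq N set0; last first.
    by exists b; rewrite ?bN //; move: bN; rewrite inE => /andP[].
  have /set0Pn[b bX] : X :\: Th != set0.
    by rewrite -card_gt0 cardsD (setIidPr ThX); lia.
  by exists b; rewrite // orbT.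
have [bTh bX'] : b \notin Th /\ b \in X by move: bX; rewrite inE => /andP[].
have [||||W [ThW WX cW eW]] := IH (X :\ b).
- by rewrite subsetD1 ThX.
- by have := cardsD1 b X; rewrite bX'; lia.
- set N' := [set v in _ | _].
  have sub : N' \subset q^-1%g b |: (N :\ b).
    apply/subsetP => v; rewrite !inE negb_and negbK -!andbA => /and4P[vTh vb vX].
    rewrite vTh vb vX /=.
    by case/orP => [/eqP <-|->]; rewrite ?permK ?eqxx ?orbT.
  have := subset_leq_card sub; have [+ _] := leq_card_setU [set q^-1%g b] (N :\ b).
  rewrite cards1; case/orP: bN => [bN|/eqP N0].
    by have := cardsD1 b N; rewrite bN -/N in eX *; lia.
  by rewrite N0 set0D cards0; lia.
- by have := cardsD1 b X; rewrite bX' Tht; lia.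
exists W; split=> //; exact: subset_trans WX (subD1set _ _).
Qed.

(** [W :|: q @: W] consists of the vertices on some arc of [q] with tail in [W], and [W :&: q @: W]
    of those on two. The new arcs touch neither the old ones nor each other, so each adds two
    vertices of [S] lying on exactly one. *)
Lemma union_arcs (T : finType) (q : {perm T}) (S W A : {set T}) :
    A \subset S :\: (W :|: q @: W) -> q @: A \subset S :\: (W :|: q @: W) ->
    [disjoint A & q @: A] ->
  let W' := W :|: A in
  [/\ W' :&: q @: W' = W :&: q @: W,
      #|S :&: (W' :|: q @: W')| = #|S :&: (W :|: q @: W)| + 2 * #|A| &
      ~: S :&: (W' :|: q @: W') = ~: S :&: (W :|: q @: W)].
Proof.
move=> /subsetP AU /subsetP qAU dA /=.
have AE v : v \in A -> [/\ v \in S, v \notin W & v \notin q @: W].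
  by move/AU; rewrite !inE negb_or => /andP[/andP[]].
have qAE v : v \in q @: A -> [/\ v \in S, v \notin W & v \notin q @: W].
  by move/qAU; rewrite !inE negb_or => /andP[/andP[]].
have dAE v : v \in A -> v \in q @: A = false by move=> /(disjointFr dA).
rewrite imsetU; split.
- apply/setP => v; rewrite !inE.
  have := AE v; have := qAE v; have := dAE v.
  case: (v \in A) => [/(_ isT) ->|_]; first by move=> _ /(_ isT)[_ /negPf -> /negPf ->].
  by case: (v \in q @: A) => [/(_ isT)[_ /negPf -> /negPf ->]|_ _]; rewrite ?orbF.
- have -> : #|S :&: (W :|: A :|: (q @: W :|: q @: A))| =
            #|S :&: (W :|: q @: W)| + #|A :|: q @: A|.
    rewrite -cardsUI [X in _ + X](_ : _ = 0) ?addn0; last first.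
      apply/eqP; rewrite cards_eq0; apply/eqP/setP => v; rewrite !inE.
      have := AE v; have := qAE v.
      case: (v \in A) => [_ /(_ isT)[_ /negPf -> /negPf ->]|]; rewrite ?andbF //.
      by case: (v \in q @: A) => [/(_ isT)[_ /negPf -> /negPf ->]|]; rewrite ?andbF.
    apply: eq_card => v; rewrite !inE; have := AE v; have := qAE v.
    case: (v \in A) => [_ /(_ isT)[-> /negPf -> /negPf ->] //|].
    by case: (v \in q @: A) => [/(_ isT)[-> /negPf -> /negPf ->] //|]; rewrite !orbF.
  rewrite cardsU (disjoint_setI0 dA) cards0 subn0 card_imset; last exact: perm_inj.
  by rewrite addnn mul2n.
apply/setP => v; rewrite !inE; have := AE v; have := qAE v.
case: (v \in A) => [_ /(_ isT)[-> _ _] //|].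
by case: (v \in q @: A) => [/(_ isT)[-> _ _] //|]; rewrite !orbF.
Qed.

(** Sort the arcs with tail in [W] by their heads: in [W], in [B] (tail in [Th]), or red outside
    [W], the last being [e] in number. *)
Lemma red_trace (T : finType) (q : {perm T}) (B Th W : {set T}) :
    Th \subset W -> W \subset ~: B -> {in W, forall v, (q v \in B) = (v \in Th)} ->
  let e := #|[set v in W :\: Th | q v \notin W]| in
  [/\ #|W :&: q @: W| + #|Th| + e = #|W|, #|~: B :&: (W :|: q @: W)| = #|W| + e &
      B :&: (W :|: q @: W) = q @: Th].
Proof.
move=> ThW WB qB; set N := [set v in _ | _] => e.
have WB' v : v \in W -> v \in B = false.
  by move=> /(subsetP WB); rewrite inE => /negPf.
have ThW' v : v \in Th -> v \in W by apply: (subsetP ThW).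
have qTh v : v \in Th -> q v \notin W.
  by move=> vTh; apply/negP => /WB'; rewrite qB ?ThW' // vTh.
split.
- have -> : #|W :&: q @: W| = #|[set v in W | q v \in W]|.
    rewrite -[RHS](card_imset _ (@perm_inj _ q)); apply: eq_card => v.
    by rewrite [RHS]mem_perm_imset !inE mem_perm_imset permKV andbC.
  rewrite -addnA (_ : #|Th| + e = #|[set v in W | q v \notin W]|).
    rewrite -(cardsID [set v | q v \in W] W); congr (_ + _).
      by apply: eq_card => v; rewrite !inE.
    by apply: eq_card => v; rewrite !inE andbC.
  rewrite addnC -(cardsID Th [set v in W | _]) addnC; congr (_ + _).
    apply: eq_card => v; rewrite !inE; case: (boolP (v \in Th)) => [vTh|_]; rewrite ?andbF //.
    by rewrite ThW' //= qTh.
  by apply: eq_card => v; rewrite !inE; case: (v \in Th).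
- have -> : #|W| + e = #|W :|: q @: N|.
    rewrite cardsU -[#|q @: N|](card_imset _ (@perm_inj _ q^-1)).
    rewrite -imset_comp (eq_imset _ (_ : _ =1 id)) ?imset_id; last by move=> v /=; rewrite permK.
    rewrite (_ : W :&: q @: N = set0) ?cards0 ?subn0 //.
    apply/setP => v; rewrite !inE mem_perm_imset !inE permKV.
    by case: (v \in W); rewrite ?andbF.
  apply: eq_card => v; rewrite !inE !mem_perm_imset !inE permKV.
  case: (boolP (v \in W)) => [/WB' -> //|vW] /=.
  case: (boolP (_ \in W)) => [/qB|]; rewrite ?andbF ?andbT //.
  by rewrite permKV => ->.
apply/setP => v; rewrite !inE !mem_perm_imset.
case: (boolP (v \in W)) => [vW|_] /=.
  rewrite WB' //=; apply/esym/negbTE; apply: contraFN (WB' v vW) => vTh.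
  by rewrite -(permKV q v) qB ?ThW'.
case: (boolP (_ \in W)) => [/qB|vW]; first by rewrite permKV andbT.
by rewrite andbF; apply/esym/negbTE; apply: contra vW; apply: ThW'.
Qed.

Lemma subset_between (T : finType) (A B : {set T}) (t : nat) :
    A \subset B -> #|A| <= t <= #|B| ->
  exists W : {set T}, [/\ A \subset W, W \subset B & #|W| = t].
Proof.
move=> AB /andP[At tB].
have : t - #|A| <= #|B :\: A| by rewrite cardsD (setIidPr AB) leq_sub2r.
case/card_geqP => s [us ss sB].
have cs : #|[set x in s]| = t - #|A| by rewrite cardsE (card_uniqP us) ss.
have sBA : [set x in s] \subset B :\: A by apply/subsetP => x; rewrite inE => /sB.
exists (A :|: [set x in s]); split; first exact: subsetUl.
  by rewrite subUset AB (subset_trans sBA (subsetDl _ _)).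
rewrite cardsU cs (_ : A :&: _ = set0) ?cards0; first by lia.
apply/eqP; rewrite setI_eq0 disjoint_sym disjoints_subset.
by apply: subset_trans sBA _; apply: subsetDr.
Qed.

(** [Th] is the set of exits into [B] that [W] keeps; the other exits are discarded before peeling.
    Disjoint red arcs then raise the number of red vertices on an arc to [2 * k] or one more. *)
Lemma red_tails (T : finType) (q : {perm T}) (B Th : {set T}) (k : nat) :
    let Ex := [set v in ~: B | q v \in B] in
    let long := [set v in Ex :\: Th | q^-1%g v \notin B] in
    (forall v, q v != v) -> #|~: B| = (3 * k).+1 -> #|Ex| <= 2 * k ->
    Th \subset Ex -> #|Th| < k -> #|Th| = k.-1 \/ #|Ex| <= #|Th| + 2 ->
    #|long| <= 1 \/ [/\ #|long| <= 2, #|Th| + 3 <= k & #|Ex| < 2 * k] ->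
  exists W : {set T}, [/\ W \subset ~: B, k <= #|W :&: q @: W| <= k.+1,
    2 * k <= #|~: B :&: (W :|: q @: W)| <= (2 * k).+1 &
    B :&: (W :|: q @: W) = q @: Th].
Proof.
move=> Ex long q_fp cR cEx ThEx Thk Th_many long_few.
pose X := ~: B :\: (Ex :\: Th).
have ExR : Ex \subset ~: B by apply/subsetP => v; rewrite inE => /andP[].
have ThX : Th \subset X.
  apply/subsetP => v vTh; rewrite !inE vTh /=.
  by have := subsetP ThEx v vTh; rewrite !inE => /andP[].
have cX : #|X| + #|Ex| = (3 * k).+1 + #|Th|.
  have := cardsID (Ex :\: Th) (~: B); rewrite (setIidPr (subset_trans (subsetDl _ _) ExR)).
  by have := cardsID Th Ex; rewrite (setIidPr ThEx) -/X cR; lia.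
(* [X] has no exits outside [Th], so the head [q v] is red; being outside [X], it is a discarded
   exit with a red predecessor. *)
have eX : #|[set v in X :\: Th | q v \notin X]| <= #|long|.
  rewrite -(card_imset _ (@perm_inj _ q)); apply: subset_leq_card.
  apply/subsetP => v; rewrite mem_perm_imset !inE !permKV.
  set u := (q^-1)%g v; case: (u \in Th) => //=.
  case: (u \in B) => //=; case: (v \in B) => //=.
  by rewrite !andbT negbK.
pose e (W : {set T}) := #|[set v in W :\: Th | q v \notin W]|.
(* By [red_trace], either size makes [#|W :&: q @: W|] equal to [k] or [k + 1]. If the larger set
   has at most one leaving arc, it is peeled once more. *)
have [W [ThW WX WE]] : exists W : {set T}, [/\ Th \subset W, W \subset X &
    (#|W| = k + #|Th| + 1 /\ e W <= 1) \/
    (#|W| = k + #|Th| + 2 /\ e W = 2 /\ #|Th| + 3 <= k)].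
  case: long_few => [long1|[long2 Thk3 cEx1]].
    have [||W [ThW WX cW eW]] := @peel T q Th X 1 (k + #|Th| + 1) ThX isT;
      try by clear -eX long1 cX cEx Thk; lia.
    by exists W; split=> //; left.
  have [||W [ThW WX cW eW]] := @peel T q Th X 2 (k + #|Th| + 2) ThX isT;
    try by clear -eX long2 cX cEx1 Thk; lia.
  have [e2|e1] := eqVneq (e W) 2; first by exists W; split=> //; right.
  have [||V [ThV VW cV eV]] := @peel T q Th W 1 (k + #|Th| + 1) ThW isT.
  - by rewrite -/(e W) in eW *; clear -eW e1; lia.
  - by clear -cW; lia.
  by exists V; split=> //; [apply: subset_trans VW WX|left].
have WR : W \subset ~: B by apply: subset_trans WX (subsetDl _ _).
have qB v : v \in W -> (q v \in B) = (v \in Th).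
  move=> vW; have := subsetP WX v vW; rewrite !inE negb_and negbK.
  case: (boolP (v \in Th)) => [vTh _|_ /=].
    by have := subsetP ThEx v vTh; rewrite !inE => /andP[].
  by move=> /andP[+ vB]; rewrite vB /= => /negbTE.
have [cI cU bU] := red_trace ThW WR qB; rewrite -/(e W) in cI cU.
set f := #|~: B :&: _| in cU.
pose U := ~: B :\: (W :|: q @: W).
have cf : #|U| + f = (3 * k).+1 by rewrite -cR -(cardsID (W :|: q @: W) (~: B)) addnC.
(* An arc from [U] with head outside [U] either is a discarded exit or ends in [W] outside [q @: W],
   a set of [#|Th| + e W] vertices. *)
have arcs : #|U| <= #|[set v in U | q v \in U]| + (#|Ex| - #|Th|) + (#|Th| + e W).
  have sub : U \subset [set v in U | q v \in U] :|: (Ex :\: Th) :|: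
                       q^-1%g @: (W :\: (W :&: q @: W)).
    apply/subsetP => v vU; rewrite !inE !mem_perm_imset !inE mem_perm_imset invgK permK.
    move: vU; rewrite !inE mem_perm_imset negb_or => /andP[/andP[vW vqW] vB].
    have vTh : v \notin Th by apply: contra vW; apply: (subsetP ThW).
    rewrite vW vB vqW vTh /=; case: (q v \in B); rewrite ?orbT //=.
    by rewrite (negPf vW) orbF andbF; case: (q v \in W).
  have := subset_leq_card sub.
  have [+ _] := leq_card_setU ([set v in U | q v \in U] :|: (Ex :\: Th))
                 (q^-1%g @: (W :\: (W :&: q @: W))).
  have [+ _] := leq_card_setU [set v in U | q v \in U] (Ex :\: Th).
  rewrite card_imset; last exact: perm_inj.
  have := cardsID (W :&: q @: W) W; rewrite (setIidPr (subsetIl _ _)).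
  have := cardsID Th Ex; rewrite (setIidPr ThEx).
  by clear -cI; lia.
have [|A [AU qAU dA cA]] := @disjoint_arcs T q U ((2 * k - f).+1)./2 q_fp.
  by clear -arcs WE cU cf Thk Th_many; lia.
have [I1 c1 b1] := union_arcs AU qAU dA.
exists (W :|: A); rewrite I1 c1 cA -/f; rewrite setCK bU in b1; split=> //.
- by rewrite subUset WR; apply: subset_trans AU (subsetDl _ _).
- by clear -cI WE; lia.
- by clear -cU WE Thk; lia.
Qed.

(** The elements of [long] are the middles of paths of [q] coloured red, red, blue. With the first
    two vertices of a path as tails, its vertices lie on one, two and one arcs. *)
Lemma tails_long (T : finType) (q : {perm T}) (B E : {set T}) (k : nat) :
    let long := [set v in ~: B | (q v \in B) && (q^-1%g v \notin B)] in
    E \subset ~: B -> #|E| <= 1 -> k + #|E| <= #|long| ->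
  exists W : {set T}, [/\ B :&: (W :&: q @: W) = set0, #|W :&: q @: W| = k,
    #|~: B :&: (W :|: q @: W)| = 2 * k, #|B :&: (W :|: q @: W)| = k &
    [disjoint E & W :|: q @: W]].
Proof.
move=> long EB E1 klong.
have [L [Llong cL LE]] : exists L : {set T}, [/\ L \subset long, #|L| = k &
    forall v, v \in L -> q v \notin E /\ v \notin E /\ q^-1%g v \notin E].
  (* These paths are pairwise disjoint, so the at most one element of [E] spoils at most one of
     them. *)
  pose bad := [set v in long | (v \in E) || (q^-1%g v \in E)].
  have bad_le : #|bad| <= #|E|.
    have [->|[r rE]] := set_0Vmem bad; first by rewrite cards0.
    suff : bad \subset [set r] /\ 0 < #|E|.
      by case=> /subset_leq_card; rewrite cards1; clear; lia.
    have E_eq u v : u \in E -> v \in E -> u = v.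
      by move=> uE vE; apply: (card_le1_eqP E1).
    move: rE; rewrite !inE => /andP[/and3P[rB qrB qVrB] rE]; split; last first.
      by apply/card_gt0P; case/orP: rE; [exists r|exists (q^-1%g r)].
    apply/subsetP => v; rewrite !inE => /andP[/and3P[vB qvB qVvB] vE].
    apply/eqP; case/orP: rE => rE; case/orP: vE => vE.
    - exact: E_eq.
    - by have rv := E_eq _ _ rE vE; rewrite rv permKV (negPf vB) in qrB.
    - by have rv := E_eq _ _ rE vE; rewrite -rv permKV (negPf rB) in qvB.
    by apply: (perm_inj (s := q^-1%g)); apply: E_eq.
  have [||L [_ Lsub cL]] := @subset_between T set0 (long :\: bad) k.
  - exact: sub0set.
  - rewrite cards0 /=; have := cardsID bad long.
    by have := subset_leq_card (subsetIr long bad); clear -klong bad_le; lia.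
  exists L; split=> // [|v /(subsetP Lsub)].
    exact: subset_trans Lsub (subsetDl _ _).
  rewrite !inE => /andP[+ /and3P[vB qvB qVvB]].
  rewrite vB qvB qVvB /= negb_or => /andP[vE qVvE]; split=> //.
  by apply: contraL qvB => /(subsetP EB); rewrite inE.
have LP v : v \in L -> [/\ v \notin B, q v \in B & q^-1%g v \notin B].
  by move/(subsetP Llong); rewrite !inE => /and3P[].
exists (L :|: q^-1%g @: L).
have mE v : (v \in L :|: q^-1%g @: L) = (v \in L) || (q v \in L).
  by rewrite inE mem_perm_imset invgK.
have qmE v : (v \in q @: (L :|: q^-1%g @: L)) = (q^-1%g v \in L) || (v \in L).
  by rewrite mem_perm_imset mE permKV.
have q1 v : v \in L -> q v \in L = false.
  by case/LP => _ qvB _; apply/negP => /LP[]; rewrite qvB.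
have q1' v : v \in L -> q^-1%g v \in L = false.
  by move=> vL; apply/negP => /q1; rewrite permKV vL.
have q2 v : q v \in L -> q^-1%g v \in L = false.
  by case/LP => _ _; rewrite permK => vB; apply/negP => /LP[_]; rewrite permKV (negPf vB).
have UE v : (v \in (L :|: q^-1%g @: L) :|: q @: (L :|: q^-1%g @: L)) =
            [|| v \in L, q v \in L | q^-1%g v \in L].
  by rewrite in_setU mE qmE; case: (v \in L); case: (q v \in L); case: (_ \in L).
have IE : (L :|: q^-1%g @: L) :&: q @: (L :|: q^-1%g @: L) = L.
  apply/setP => v; rewrite in_setI mE qmE.
  have := q1 v; have := q1' v; have := q2 v.
  by case: (v \in L); case: (q v \in L); case: (_ \in L) => // /(_ isT).
rewrite IE; split=> //.
- by apply/setP => v; rewrite !inE; apply/negP => /andP[vB /LP[]]; rewrite vB.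
- have -> : ~: B :&: (L :|: q^-1%g @: L :|: q @: (L :|: q^-1%g @: L)) = L :|: q^-1%g @: L.
    apply/setP => v; rewrite in_setI in_setC UE mE.
    case: (boolP (v \in L)) => [/LP[->]|_] //=.
    case: (boolP (q v \in L)) => [/LP[_ _]|_] /=; first by rewrite permK => ->.
    by apply/negP => /andP[vB /LP[_]]; rewrite permKV (negPf vB).
  rewrite cardsU (_ : _ :&: _ = set0) ?cards0 ?subn0.
    by rewrite card_imset ?cL ?addnn ?mul2n //; apply: perm_inj.
  apply/setP => v; rewrite !inE mem_perm_imset invgK.
  by apply/negP => /andP[/q1 ->].
- have -> : B :&: (L :|: q^-1%g @: L :|: q @: (L :|: q^-1%g @: L)) = q @: L.
    apply/setP => v; rewrite in_setI UE mem_perm_imset.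
    case: (boolP (v \in L)) => [vL|_] /=.
      by rewrite q1' // andbT; case/LP: vL => /negPf.
    case: (boolP (q v \in L)) => [vL|_] /=.
      by rewrite q2 // andbT; case/LP: vL => _ _; rewrite permK => /negPf.
    by apply/andP/idP => [[]//|vL]; split=> //; case/LP: vL; rewrite permKV.
  by rewrite card_imset ?cL //; apply: perm_inj.
rewrite disjoint_sym disjoints_subset; apply/subsetP => v; rewrite UE in_setC.
case/or3P => [/LE[_ []]|/LE[_ [_]]|/LE[]] //; first by rewrite permK.
by rewrite permKV.
Qed.

(** [B] and its preimage have equal size, hence so have their two differences. *)
Lemma card_exits (T : finType) (q : {perm T}) (B : {set T}) :
  #|[set v in B | q v \notin B]| = #|[set v in ~: B | q v \in B]|.
Proof.
have : #|q^-1%g @: B| = #|B| by apply: card_imset; apply: perm_inj.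
rewrite -[in RHS](cardsID (q^-1%g @: B) B) -[in LHS](cardsID B (q^-1%g @: B)).
rewrite [q^-1%g @: B :&: B]setIC => /addnI eqD.
transitivity #|B :\: q^-1%g @: B|; [|rewrite -eqD]; apply: eq_card => v.
  by rewrite !inE mem_perm_imset invgK andbC.
by rewrite !inE mem_perm_imset invgK.
Qed.

(** A blue vertex whose arc is not among those counted lies in [H] or [q @: Th], or its arc enters
    [H] or leaves [B]. As many arcs leave [B] as enter it, and these have their tails in [Th] or
    their heads in [H]. *)
Lemma blue_arcs (T : finType) (q : {perm T}) (B H Th : {set T}) :
    H \subset B -> Th = [set v in ~: B | q v \in B :\: H] ->
  #|B| <= #|[set v in B :\: (H :|: q @: Th) | q v \in B :\: (H :|: q @: Th)]|
          + 2 * (#|H| + #|Th|).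
Proof.
move=> HB ThE; set Y := B :\: _.
have qH : #|q^-1%g @: H| = #|H| by apply: card_imset; apply: perm_inj.
have qTh : #|q @: Th| = #|Th| by apply: card_imset; apply: perm_inj.
pose Ex := [set v in ~: B | q v \in B].
have cEx : #|Ex| = #|Th| + #|q^-1%g @: H :\: B|.
  rewrite -(cardsID (q^-1%g @: H) Ex) addnC ThE; congr (_ + _); apply: eq_card => v.
    rewrite !inE mem_perm_imset invgK; case: (v \in B); rewrite ?andbF //=.
  rewrite !inE mem_perm_imset invgK; case: (v \in B); rewrite ?andbF //=.
  by case: (boolP (q v \in H)) => [/(subsetP HB) ->|_]; rewrite ?andbF.
have sub : B \subset [set v in Y | q v \in Y] :|: [set v in B | q v \notin B] :|:
    (q^-1%g @: H :&: B) :|: H :|: q @: Th.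
  apply/subsetP => v vB; rewrite !inE !mem_perm_imset !invgK permK vB !andbT /=.
  have -> : v \in Th = false by rewrite ThE !inE vB.
  by case: (q v \in B); case: (v \in H); case: (q v \in H); case: (_ \in Th).
have := subset_leq_card sub.
have [+ _] := leq_card_setU ([set v in Y | q v \in Y] :|: [set v in B | q v \notin B] :|:
    (q^-1%g @: H :&: B) :|: H) (q @: Th).
have [+ _] := leq_card_setU ([set v in Y | q v \in Y] :|: [set v in B | q v \notin B] :|:
    (q^-1%g @: H :&: B)) H.
have [+ _] := leq_card_setU ([set v in Y | q v \in Y] :|: [set v in B | q v \notin B])
    (q^-1%g @: H :&: B).
have [+ _] := leq_card_setU [set v in Y | q v \in Y] [set v in B | q v \notin B].
have := cardsID B (q^-1%g @: H); rewrite qH qTh card_exits -/Ex cEx.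
by clear; lia.
Qed.

(* [H] stands for the blue vertex that an arc of [p] with label 0 may enter: it already
   lacks one label [k], so [W] must avoid it. In the extremal case where [blue_arcs]
   yields no arc, an exit [v0] in [Th] is given up in favour of the arc starting at
   [q v0]. *)
Lemma tails_short (T : finType) (q : {perm T}) (B H : {set T}) (k : nat) :
    let long := [set v in ~: B | (q v \in B) && (q^-1%g v \notin B)] in
    (forall v, q v != v) -> #|~: B| = (3 * k).+1 -> #|B| <= 2 * k <= #|B| + 4 ->
    1 < k -> H \subset B -> #|H| <= 1 ->
    (#|B| = 2 -> forall h, h \in H -> q h \notin B) -> #|long| < k + #|H| ->
  exists W : {set T}, [/\ B :&: (W :&: q @: W) = set0,
    k <= #|W :&: q @: W| <= k.+1, 2 * k <= #|~: B :&: (W :|: q @: W)| <= (2 * k).+1,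
    [disjoint H & W :|: q @: W] &
    B = set0 \/ k.-1 <= #|H| + #|B :&: (W :|: q @: W)| <= k].
Proof.
move=> long q_fp cR cB k1 HB H1 small_B long_few.
pose Ex := [set v in ~: B | q v \in B].
pose Exn := [set v in ~: B | q v \in B :\: H].
pose ExH := [set v in ~: B | q v \in H].
have ExnEx : Exn \subset Ex.
  by apply/subsetP => v; rewrite !inE => /andP[-> /andP[_ ->]].
have cExH : #|ExH| <= #|H|.
  rewrite -(card_imset _ (@perm_inj _ q)); apply/subset_leq_card/subsetP => v.
  by rewrite mem_perm_imset inE permKV => /andP[].
have ExD : Ex :\: Exn \subset ExH.
  apply/subsetP => v; rewrite !inE; case: (v \in B) => //=.
  by case: (q v \in H) => //=; case: (q v \in B).
have cEx : #|Ex| <= #|B|.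
  by rewrite -card_exits; apply/subset_leq_card/subsetP => v; rewrite inE => /andP[].
have cExn : #|Ex| <= #|Exn| + #|H|.
  have := cardsID Exn Ex; rewrite (setIidPr ExnEx).
  by have := subset_leq_card ExD; clear -cExH; lia.
(* [red_tails] turns the kept exits [Th] into the red part of [W]; the blue vertices then on an arc
   are [q @: Th] and both ends of the arcs from [C]. *)
suff [Th [C [ThEx Thk Th_many long_ok [CY qCY dC cC]]]] : exists Th C : {set T},
    [/\ Th \subset Exn, #|Th| < k, #|Th| = k.-1 \/ #|Ex| <= #|Th| + 2,
      #|[set v in Ex :\: Th | q^-1%g v \notin B]| <= 1 \/
      [/\ #|[set v in Ex :\: Th | q^-1%g v \notin B]| <= 2, #|Th| + 3 <= k & #|Ex| < 2 * k] &
      [/\ C \subset B :\: (H :|: q @: Th), q @: C \subset B :\: (H :|: q @: Th),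
          [disjoint C & q @: C] &
          B = set0 \/ k.-1 <= #|H| + #|Th| + 2 * #|C| <= k]].
  have [|W [WR cI cU bU]] := red_tails q_fp cR _ (subset_trans ThEx ExnEx) Thk Th_many long_ok.
    by rewrite -/Ex; clear -cEx cB; lia.
  have BU : B :\: (H :|: q @: Th) \subset B :\: (W :|: q @: W).
    apply/subsetP => v; rewrite -bU [v \in _ :\: (W :|: _)]inE inE => /andP[+ vB].
    by rewrite vB andbT; apply: contra => vW; rewrite inE orbC inE vB vW.
  have [IE cE RE] := union_arcs (subset_trans CY BU) (subset_trans qCY BU) dC.
  have cTh : #|q @: Th| = #|Th| by apply: card_imset; apply: perm_inj.
  exists (W :|: C); rewrite IE; split=> //.
  - apply/eqP; rewrite setI_eq0 disjoint_sym disjoints_subset.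
    exact: subset_trans (subsetIl _ _) WR.
  - by rewrite RE.
  - rewrite disjoint_sym disjoints_subset; apply/subsetP => v vWC.
    rewrite inE; apply/negP => vH; have vB := subsetP HB _ vH.
    have : v \in B :&: (W :|: q @: W).
      move: vWC; rewrite imsetU !inE vB /=.
      have nY : v \notin B :\: (H :|: q @: Th) by rewrite !inE vH.
      have nC : v \notin C by apply: contra nY; apply: (subsetP CY).
      have nqC : v \notin q @: C by apply: contra nY; apply: (subsetP qCY).
      by rewrite (negPf nC) (negPf nqC) !orbF.
    rewrite bU mem_perm_imset => /(subsetP ThEx).
    by rewrite !inE permKV vH andbF.
  by rewrite cE bU cTh addnA.
have long_sub Th : [set v in Ex :\: Th | q^-1%g v \notin B] = long :\: Th.
  by apply/setP => v; rewrite !inE; case: (v \in Th); case: (v \in B).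
have C0 (Th : {set T}) : [/\ set0 \subset B :\: (H :|: q @: Th),
    q @: set0 \subset B :\: (H :|: q @: Th) & [disjoint (set0 : {set T}) & q @: set0]].
  by rewrite imset0 !sub0set disjoints_subset sub0set.
have long_ExH (Th : {set T}) : long :&: Exn \subset Th -> #|long :\: Th| <= #|H|.
  move=> sub; apply: leq_trans cExH; apply/subset_leq_card/subsetP => v.
  have := subsetP sub v; rewrite !inE; case: (v \in B) => //=.
    by rewrite !andbF.
  case: (q v \in B); rewrite ?andbF //=; case: (q v \in H) => //=.
  by rewrite andbT => vTh /andP[/negP+ vB]; case; apply: vTh.
(* With at least [k] usable exits, keep [k - 1] of them, long ones first, and no blue arc is
   needed. *)
have [Exn_big|Exn_small] := leqP k #|Exn|.
  have [Th [ThExn cTh long1]] : exists Th : {set T},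
      [/\ Th \subset Exn, #|Th| = k.-1 & #|long :\: Th| <= #|H|].
    have [L_small|L_big] := leqP #|long :&: Exn| k.-1.
      have [||Th [LTh ThExn cTh]] := @subset_between T (long :&: Exn) Exn k.-1.
      - exact: subsetIr.
      - by rewrite L_small; clear -Exn_big; lia.
      by exists Th; split=> //; apply: long_ExH.
    have [||Th [_ ThL cTh]] := @subset_between T set0 (long :&: Exn) k.-1.
    - exact: sub0set.
    - by rewrite cards0; clear -L_big; lia.
    exists Th; split=> //; first exact: subset_trans ThL (subsetIr _ _).
    have := cardsID Th long; rewrite (setIidPr (subset_trans ThL (subsetIl _ _))).
    by rewrite cTh; clear -long_few k1; lia.
  exists Th, set0; have [c1 c2 c3] := C0 Th; split=> //.
  - by clear -cTh k1; lia.
  - by left.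
  - by rewrite long_sub; left; clear -long1 H1; lia.
  by split=> //; right; rewrite cards0 cTh; clear -H1 k1; lia.
set Y := B :\: (H :|: q @: Exn).
have := blue_arcs HB (erefl Exn); rewrite -/Exn -/Y; set arcs := #|[set v in Y | _]| => arcs_ge.
pose y := (k - #|H| - #|Exn|)./2.
have [few|many] := leqP (3 * y) (arcs + 2).
  have [C [CY qCY dC cC]] := disjoint_arcs q_fp few.
  exists Exn, C; split=> //.
  - by right; clear -cExn H1; lia.
  - by rewrite long_sub; left; have := long_ExH Exn (subsetIr _ _); clear -H1; lia.
  by split=> //; right; rewrite cC /y; clear -Exn_small H1; lia.
(* Put [d = k - #|H| - #|Exn|]. Then [blue_arcs] gives at least [2 * d - 4] arcs, and too few for
   [d./2] disjoint ones only if [d = 2], with equality throughout. *)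
have [arcs0 [d2 B4]] : arcs = 0 /\ #|H| + #|Exn| + 2 = k /\ #|B| + 4 = 2 * k.
  by rewrite /y in many; clear -many arcs_ge cB; lia.
have [B0|B_neq0] := eqVneq B set0.
  exists Exn, set0; have [c1 c2 c3] := C0 Exn; split=> //.
  - by right; clear -cExn H1; lia.
  - by rewrite long_sub; left; have := long_ExH Exn (subsetIr _ _); clear -H1; lia.
  by split=> //; left.
have noarc v : v \in Y -> q v \notin Y.
  move=> vY; apply/negP => qvY; move/eqP: arcs0; rewrite cards_eq0 => /eqP/setP/(_ v).
  by rewrite inE vY qvY inE.
have cY : #|Y| + 2 = k.
  have HqE : H :&: q @: Exn = set0.
    apply/setP => v; rewrite !inE mem_perm_imset !inE permKV.
    by case: (v \in H); rewrite ?andbF.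
  have sub : H :|: q @: Exn \subset B.
    rewrite subUset HB; apply/subsetP => v; rewrite mem_perm_imset !inE permKV.
    by case/andP => _ /andP[].
  have := cardsID (H :|: q @: Exn) B; rewrite (setIidPr sub) -/Y cardsU HqE cards0.
  by rewrite card_imset; [clear -d2 B4; lia|apply: perm_inj].
have Yin v : v \in Y -> [/\ v \in B, v \notin H & q^-1%g v \notin Exn].
  by rewrite in_setD in_setU mem_perm_imset negb_or => /andP[/andP[]].
have B_gt0 : 0 < #|B| by rewrite card_gt0.
(* Otherwise [Y] has at most one element, so [k = 3] and [#|B| = 2], which [small_B] excludes. *)
have [y' /andP[y'Y y'H]] : exists y', (y' \in Y) && (q^-1%g y' \notin H).
  apply/existsP; apply: contraT => /existsPn YH.
  have YqH : Y \subset q @: H.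
    apply/subsetP => v vY; have := YH v; rewrite vY negbK mem_perm_imset; exact.
  have /set0Pn[v vY] : Y != set0 by rewrite -card_gt0; clear -cY B4 B_gt0; lia.
  have := subset_leq_card YqH; rewrite card_imset; last exact: perm_inj.
  move=> YleH; have B2 : #|B| = 2 by clear -YleH cY H1 B4 B_gt0; lia.
  have := small_B B2 (q^-1%g v); rewrite permKV -mem_perm_imset (subsetP YqH) //.
  by move=> /(_ isT); have [-> _ _] := Yin _ vY.
have [y'B y'nH y'Exn] := Yin _ y'Y.
(* [u] is blue, since otherwise it would be an exit in [Exn], and it is not in [Y]; so it is the
   head of an exit [v0]. Replacing that exit by the arc from [u] to [y'] covers one more blue
   vertex. *)
set u := (q^-1)%g y' in y'H y'Exn.
have qu : q u = y' by rewrite permKV.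
have uB : u \in B by apply: contraR y'Exn => uB; rewrite !inE uB qu y'nH y'B.
have [v0 v0E v0u] : exists2 v0, v0 \in Exn & q v0 = u.
  exists (q^-1%g u); last by rewrite permKV.
  apply: contraT => v0E; have /noarc : u \in Y; last by rewrite qu y'Y.
  by rewrite in_setD in_setU negb_or y'H mem_perm_imset v0E uB.
pose Th := Exn :\ v0.
have cTh : #|Exn| = #|Th|.+1 by rewrite (cardsD1 v0) v0E.
have longTh : #|long :\: Th| <= #|H| + 1.
  have sub : long :\: Th \subset (long :\: Exn) :|: [set v0].
    by apply/subsetP => v; rewrite !inE; case: eqVneq; rewrite ?orbT ?orbF.
  have := subset_leq_card sub; have [+ _] := leq_card_setU (long :\: Exn) [set v0].
  by rewrite cards1; have := long_ExH Exn (subsetIr _ _); clear; lia.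
exists Th, [set u]; split.
- exact: subD1set.
- by clear -cTh Exn_small; lia.
- by right; clear -cExn cTh H1; lia.
- by rewrite long_sub; right; split; [clear -longTh H1|clear -cTh d2|clear -cEx B4]; lia.
split.
- by rewrite sub1set in_setD in_setU negb_or y'H uB mem_perm_imset -v0u permK !inE eqxx.
- rewrite imset_set1 sub1set in_setD in_setU negb_or qu y'nH y'B mem_perm_imset.
  by rewrite in_setD1 (negPf y'Exn) andbF.
- by rewrite imset_set1 disjoints1 inE eq_sym q_fp.
by right; rewrite cards1; clear -cTh d2; lia.
Qed.

(** * Labels for at least seven vertices *)

(** Grow [B] along the cycles of [p]: add the head of the exit if there is one, else any new vertex.
    Only the arc of the newest vertex can leave [B]. *)
Lemma perm_interval (T : finType) (p : {perm T}) (m : nat) :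
  m <= #|T| -> exists B : {set T}, #|B| = m /\ #|[set v in B | p v \notin B]| <= 1.
Proof.
elim: m => [|m IH] mT.
  exists set0; rewrite cards0 (_ : [set v in set0 | _] = set0) ?cards0 //.
  by apply/setP => v; rewrite !inE.
have [|B [cB exits]] := IH; first exact: ltnW.
have [u uB sub] : exists2 u, u \notin B & [set v in B | p v \notin B] \subset [set p^-1 u]%g.
  have [X0|[v vX]] := set_0Vmem [set v in B | p v \notin B].
    have /set0Pn[u] : ~: B != set0 by rewrite -card_gt0; have := cardsC B; lia.
    by rewrite inE => uB; exists u; rewrite // X0 sub0set.
  have := vX; rewrite inE => /andP[vB pvB]; exists (p v) => //.
  by apply/subsetP => w wX; rewrite permK inE; apply/eqP/(card_le1_eqP exits).
exists (u |: B); rewrite cardsU1 uB cB; split=> //.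
rewrite -(cards1 u); apply/subset_leq_card/subsetP => v; rewrite !inE.
case/andP=> /orP[//|vB]; rewrite negb_or => /andP[pvu pvB].
have := subsetP sub v; rewrite !inE vB pvB => /(_ isT)/eqP vE.
by rewrite vE permKV eqxx in pvu.
Qed.

(** Up to one vertex with 1 too much and one with [k - 1] too little, [sg] is [k * dg]. At
    [j = k * i + r] the first can be missing only if [r = 0], where the lower bound has slack as
    [1 < k]; the second can be extra only if [r > 0], where the upper bound has slack. *)
Lemma band_of_classes (T : finType) (sg dg : T -> nat) (S1 S2 : {set T}) (k : nat) :
    1 < k -> #|S1| <= 1 -> #|S2| <= 1 ->
    (forall v, sg v + k.-1 * (v \in S2) = k * dg v + (v \in S1)) ->
    (forall i, #|[set v | dg v <= i]| <= (i.+1 * k).+1) ->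
    (forall i, i.+1 * k <= #|[set v | dg v <= i]| \/
       [set v | dg v <= i] = setT /\ {in S1, forall v, dg v <> i}) ->
  forall j, j < #|T| -> j < #|[set v | sg v <= j]| <= j.+1 + k.
Proof.
move=> k1 cS1 cS2 sgE up lo j jT.
have k0 : 0 < k by lia.
pose i := j %/ k; pose r := j %% k.
have jE : j = k * i + r by rewrite mulnC; apply: divn_eq.
have rk : r < k by rewrite ltn_mod.
pose N i := [set v | dg v <= i].
have loN : N i :\: (if r == 0 then [set v in S1 | dg v == i] else set0)
             \subset [set v | sg v <= j].
  apply/subsetP => v; rewrite !inE => /andP[vS vi]; have := sgE v.
  have : k * dg v <= k * i by rewrite leq_mul2l vi orbT.
  case: eqP vS => [r0|r0 _]; last by case: (v \in S1); lia.
  rewrite !inE; case: (v \in S1) => /=; last by lia.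
  move=> vi'; have : k * (dg v).+1 <= k * i by rewrite leq_mul2l; lia.
  by rewrite mulnS; lia.
have upN : [set v | sg v <= j] \subset N i :|: (if r == 0 then set0 else S2).
  apply/subsetP => v; rewrite !inE => vj; have := sgE v.
  case: (leqP (dg v) i) => //= vi; have : k * i.+1 <= k * dg v by rewrite leq_mul2l vi orbT.
  rewrite mulnS; case: eqP => r0; rewrite ?inE; case: (v \in S2) => //=; rewrite ?muln0 ?muln1; lia.
have := subset_leq_card loN; have := subset_leq_card upN; have := up i; have := lo i.
rewrite -/(N i) mulSn mulnC => loi upi.
have [+ _] := leq_card_setU (N i) (if r == 0 then set0 else S2).
have := cardsID (if r == 0 then [set v in S1 | dg v == i] else set0) (N i).
have := subset_leq_card (subsetIr (N i) (if r == 0 then [set v in S1 | dg v == i] else set0)).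
have S1i : #|[set v in S1 | dg v == i]| <= 1.
  by apply: leq_trans cS1; apply/subset_leq_card/subsetP => v; rewrite inE => /andP[].
case: loi => [loi|[NT S1N]].
  by case: eqP => r0; rewrite ?cards0; lia.
have -> : [set v in S1 | dg v == i] = set0.
  by apply/setP => v; rewrite !inE; apply/negP => /andP[/S1N vi /eqP].
have cN : #|N i| = #|T| by rewrite NT cardsT.
by case: eqP => r0; rewrite ?cards0; lia.
Qed.

(* The arc of [p] leaving [B] gets the label 1, the one entering [B] gets [k] or 0
   according to [cA]. *)
Lemma band_of_tails (T : finType) (p q : {perm T}) (B W : {set T}) (k : nat) (cA : bool) :
    let Es := [set v in ~: B | p v \in B] in
    let H := if cA then set0 else p @: Es in
    1 < k -> #|~: B| = (3 * k).+1 -> #|B| <= 2 * k ->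
    #|[set v in B | p v \notin B]| <= 1 ->
    B :&: (W :&: q @: W) = set0 -> k <= #|W :&: q @: W| <= k.+1 ->
    2 * k <= #|~: B :&: (W :|: q @: W)| <= (2 * k).+1 ->
    [disjoint (if cA then Es else H) & W :|: q @: W] ->
    B = set0 \/ k.-1 <= #|H| + #|B :&: (W :|: q @: W)| <= k ->
  exists x z : T -> nat, [/\ forall v, x v <= k, forall v, z v <= k &
    forall j, j < #|T| ->
      j < #|[set v | x v + x (p^-1%g v) + z v + z (q^-1%g v) <= j]| <= j.+1 + k].
Proof.
move=> Es H k1 cR cB exits BW D_k f_k dE tau_k.
pose Xs := [set v in B | p v \notin B].
pose a v := ((v \in B) && (p v \in B)) + (cA && (v \in Es)).
pose c v : nat := v \notin W.
have cT : #|T| = #|B| + (3 * k).+1 by rewrite -cR cardsC.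
have a1 v : a v + (v \in Xs) <= 1.
  by rewrite /a !inE; case: (v \in B); case: (p v \in B); case: (cA).
exists (fun v => k * a v + (v \in Xs)), (fun v => k * c v); split.
- move=> v; have := a1 v; case: (a v) => [|[|//]]; rewrite ?muln0 ?muln1; lia.
- by move=> v; rewrite /c; case: (v \in W); lia.
(* The arc of label 1 leaving [B] counts as [k] at its blue tail and as 0 at its red head: the sum
   is [k - 1] less than [k * dg] at the tail and 1 more at the head. *)
pose dg v := a v + a (p^-1%g v) + c v + c (q^-1%g v) + (v \in Xs).
have BW' v : v \in B -> (v \in W) && (v \in q @: W) = false.
  by move=> vB; have := in_set0 v; rewrite -BW in_setI vB in_setI.
have dg_blue v : v \in B ->
    dg v = 4 - ((v \in H) || (v \in W :|: q @: W)).
  move=> vB; rewrite /dg /a /c !inE permKV vB mem_perm_imset /=.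
  have := BW' v vB; rewrite mem_perm_imset.
  have vH : (v \in H) = ~~ cA && (p^-1%g v \notin B).
    by rewrite /H; case: (cA); rewrite ?inE //= mem_perm_imset !inE permKV vB andbT.
  have : v \in H -> (v \notin W) && (q^-1%g v \notin W).
    move: dE vH; case: (cA) => [_ -> //|dE' _ vH']; have := disjointFr dE' vH'.
    by move/negbT; rewrite inE mem_perm_imset negb_or.
  rewrite vH; case: (p v \in B); case: (p^-1%g v \in B); case: (v \in W);
  by case: (q^-1%g v \in W); case: (cA) => //= /(_ isT).
have dg_red v : v \in B = false ->
    dg v = (if cA && (v \in Es) then 3 else 2) - (v \in W) - (v \in q @: W).
  move=> vB; rewrite /dg /a /c !inE permKV vB mem_perm_imset /= !andbF !addn0.
  by case: (cA); case: (p v \in B); case: (v \in W); case: (q^-1%g v \in W).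
have Es_free v : cA && (v \in Es) -> (v \in W = false) * (v \in q @: W = false).
  case/andP=> hA vE; move: dE; rewrite hA => /disjointFr/(_ vE).
  by rewrite inE => /norP[/negPf -> /negPf ->].
have N0 : [set v | dg v <= 0] = W :&: q @: W.
  apply/setP => v; rewrite [LHS]inE; case vB: (v \in B).
    by rewrite dg_blue // in_setI BW' //; case: (_ || _).
  rewrite dg_red // in_setI; have := Es_free v.
  by case: (cA && _) => [/(_ isT)[-> ->]//|_]; case: (v \in W); case: (v \in q @: W).
have N1 : [set v | dg v <= 1] = ~: B :&: (W :|: q @: W).
  apply/setP => v; rewrite [LHS]inE in_setI in_setC in_setU; case vB: (v \in B).
    by rewrite dg_blue //; case: (_ || _).
  rewrite dg_red //; have := Es_free v.
  by case: (cA && _) => [/(_ isT)[-> ->]//|_]; case: (v \in W); case: (v \in q @: W).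
have N2 : ~: B :\: Es \subset [set v | dg v <= 2] /\ [set v | dg v <= 2] \subset ~: B.
  split; apply/subsetP => v.
    rewrite in_setD in_setC => /andP[/negPf vE /negPf vB]; rewrite inE dg_red // vE andbF.
    by case: (v \in W); case: (v \in q @: W).
  by rewrite inE in_setC; apply: contraTN => vB; rewrite dg_blue //; case: (_ || _).
(* The [3 k + 1] red vertices together with [k - 1] or [k] blue ones make up the required [4 k] or
   [4 k + 1]. *)
have N3 : [set v | dg v <= 3] = ~: B :|: (H :|: B :&: (W :|: q @: W)).
  apply/setP => v; rewrite inE in_setU in_setC in_setU in_setI; case vB: (v \in B) => /=.
    by rewrite dg_blue //; case: (_ || _).
  by rewrite dg_red // !leq_subLR; case: (cA && _); lia.
have dg4 v : dg v <= 4.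
  case vB: (v \in B); first by rewrite dg_blue //; lia.
  by rewrite dg_red // !leq_subLR; case: (cA && _); lia.
have cEs : #|Es| <= 1 by rewrite -card_exits.
have cN3 : #|[set v | dg v <= 3]| = (3 * k).+1 + (#|H| + #|B :&: (W :|: q @: W)|).
  have HB : H \subset B.
    rewrite /H; case: (cA); first exact: sub0set.
    by apply/subsetP => v; rewrite mem_perm_imset !inE permKV => /andP[].
  rewrite N3 cardsU cR (_ : ~: B :&: _ = set0) ?cards0 ?subn0; last first.
    apply/eqP; rewrite setI_eq0 disjoint_sym disjoints_subset setCK.
    by rewrite subUset HB subsetIl.
  rewrite cardsU (_ : H :&: _ = set0) ?cards0 ?subn0 //.
  apply/eqP; rewrite setI_eq0 disjoints_subset; apply/subsetP => v vH.
  rewrite !inE negb_and; apply/orP; right.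
  move: dE vH; rewrite /H; case: (cA); first by rewrite inE.
  by move=> dE' vH'; rewrite -in_setU (disjointFr dE' vH').
have cN2 : 3 * k <= #|[set v | dg v <= 2]| <= (3 * k).+1.
  have := subset_leq_card N2.1; have := subset_leq_card N2.2.
  have := cardsID Es (~: B); have := subset_leq_card (subsetIr (~: B) Es).
  by rewrite cR; lia.
have NT i : 4 <= i -> [set v | dg v <= i] = setT.
  by move=> i4; apply/setP => v; rewrite !inE; have := dg4 v; lia.
apply: (@band_of_classes _ _ dg (p @: Xs) Xs) => //.
- by rewrite card_imset //; apply: perm_inj.
- move=> v; rewrite mem_perm_imset /dg !mulnDr.
  set u := (p^-1%g v); set w := (q^-1%g v).
  move: (k * a v) (k * a u) (k * c v) (k * c w) (u \in Xs) => a1v a2v c1v c2v b.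
  by case: (v \in Xs); rewrite ?muln0 ?muln1; clear -k1; lia.
- case=> [|[|[|[|i]]]]; rewrite ?N0 ?N1; try lia.
    case: tau_k => [B0|]; last by rewrite cN3; lia.
    by apply: leq_trans (max_card _) _; rewrite cT B0 cards0; lia.
  by apply: leq_trans (max_card _) _; rewrite cT; lia.
case=> [|[|[|[|i]]]]; rewrite ?N0 ?N1; try by left; lia.
  case: tau_k => [B0|]; last by rewrite cN3; left; lia.
  right; split; first by rewrite N3 B0 setC0 setTU.
  by move=> v; rewrite mem_perm_imset inE B0 inE.
(* From class 4 on all vertices are included, and the exceptional head is red, hence of class at
   most 3. *)
right; split; first exact: NT.
move=> v; rewrite mem_perm_imset !inE permKV => /andP[_ /negPf vB].
by rewrite dg_red //; case: (cA && _); lia.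
Qed.

(** The bounds on [#|T|] say that [B] has between [2 k - 4] and [2 k] elements. The number of long
    exits decides whether the arc of [p] entering [B] gets [k] (many) or 0 (few). *)
Lemma band_of_perms (T : finType) (p q : {perm T}) (k : nat) :
    (forall v, p v != v) -> (forall v, q v != v) -> (forall v, p v != q v) ->
    1 < k -> #|T| <= 5 * k + 1 -> 5 * k <= #|T| + 3 ->
  exists x z : T -> nat, [/\ forall v, x v <= k, forall v, z v <= k &
    forall j, j < #|T| ->
      j < #|[set v | x v + x (p^-1%g v) + z v + z (q^-1%g v) <= j]| <= j.+1 + k].
Proof.
move=> p_fp q_fp pq k1 T_le T_ge.
have [|B [cB exits]] := @perm_interval T p (#|T| - (3 * k).+1); first exact: leq_subr.
have cR : #|~: B| = (3 * k).+1 by have := cardsC B; lia.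
pose Es := [set v in ~: B | p v \in B].
have cEs : #|Es| <= 1 by rewrite -card_exits.
have cH : #|p @: Es| = #|Es| by apply: card_imset; apply: perm_inj.
pose long := [set v in ~: B | (q v \in B) && (q^-1%g v \notin B)].
have [long_few|long_many] := ltnP #|long| (k + #|Es|).
  have [|||||W [BW D f dH tau]] := @tails_short T q B (p @: Es) k q_fp cR _ k1; rewrite ?cH //.
  - by lia.
  - by apply/subsetP => v; rewrite mem_perm_imset !inE permKV => /andP[].
  (* If [q h] were blue, then [B = {h, q h}] and [p h] is red. The arc of [h] is then the only one
     of [p] leaving [B], so [p] maps [q h] to [h], contradicting that [h] is entered from a red
     vertex. *)
  - move=> B2 h; rewrite mem_perm_imset !inE permKV => /andP[pVh hB]; apply/negP => qhB.
    have B_eq v : v \in B -> v = h \/ v = q h.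
      move=> vB; have /eqP BE : [set h; q h] == B.
        by rewrite eqEcard subUset !sub1set hB qhB cards2 eq_sym q_fp B2.
      by move: vB; rewrite -BE !inE => /orP[]/eqP; [left|right].
    have phB : p h \notin B.
      by apply/negP => /B_eq[/eqP|/eqP]; apply/negP.
    have pqhB : p (q h) \in B.
      apply: contraT => pqhB; have /eqP := q_fp h; case.
      by apply: (card_le1_eqP exits); rewrite inE ?qhB ?hB.
    have [pqh|/eqP] := B_eq _ pqhB; last by apply/negP.
    by rewrite -pqh permK qhB in pVh.
  apply: (@band_of_tails T p q B W k false) => //; first by lia.
have [|W [BW D f tau dE]] := @tails_long T q B Es k _ cEs long_many.
  by apply/subsetP => v; rewrite inE => /andP[].
apply: (@band_of_tails T p q B W k true) => //; try by lia.
by right; rewrite cards0 tau; lia.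
Qed.

Lemma labeling_large (G : sgraph) (k : nat) :
    regular 4 G -> 1 < k -> #|G| <= 5 * k + 1 -> 5 * k <= #|G| + 3 ->
  exists lam : labeling k.+1 G,
    [/\ total_labeling lam, vertex_irregular lam &
        forall w : nat, (exists v : G, wt lam v = w) <-> 5 <= w <= #|G| + 4].
Proof.
move=> reg4 k1 G_le G_ge; have [p [q pqE]] := two_factorization reg4.
have adj_fp (r : {perm G}) : (forall v, adj v (r v)) -> forall v, r v != v.
  by move=> ar v; apply: contraTneq (ar v) => ->; rewrite adj_irr.
have p_fp : forall v, p v != v.
  by apply: adj_fp => v; have [_ ->] := pqE v; rewrite inE eqxx.
have q_fp : forall v, q v != v.
  by apply: adj_fp => v; have [_ ->] := pqE v; rewrite !inE eqxx !orbT.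
have pq v : p v != q v.
  by have [/= /andP[+ _] _] := pqE v; rewrite !inE !negb_or => /and3P[].
have [x [z [xk zk band]]] := band_of_perms p_fp q_fp pq k1 G_le G_ge.
(* An arc carries the label stored at its tail. Neither permutation has 2-cycles, so the tail is
   unambiguous; non-edges get 0. *)
pose y u w := if w == p u then x u else if u == p w then x w else
              if w == q u then z u else if u == q w then z w else 0.
have no2 (r : {perm G}) u w : r u != (r^-1 u)%g -> (w == r u) && (u == r w) = false.
  by apply: contraNF => /andP[/eqP wr /eqP ur]; rewrite {2}ur permK -wr.
have pp v : p v != (p^-1 v)%g.
  by have [/= /andP[+ _] _] := pqE v; rewrite !inE !negb_or => /and3P[].
have qq v : q v != (q^-1 v)%g.
  by have [/= /and4P[_ _ + _] _] := pqE v; rewrite !inE.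
have sumE v : \sum_(w | adj v w) y v w = x v + x (p^-1%g v) + z v + z (q^-1%g v).
  have [un adjE] := pqE v.
  rewrite (eq_bigl _ _ adjE) -(big_uniq _ un) /= !big_cons big_nil /y addn0 !addnA.
  move: un; rewrite /= !inE !negb_or !permKV !eqxx.
  case/and4P=> /and3P[n1 n2 n3] /andP[n4 n5] n6 _.
  have nV (r : {perm G}) (a b : G) : (a == r b) = (r^-1%g a == b).
    by apply/eqP/eqP => [->|<-]; rewrite ?permK ?permKV.
  rewrite (eq_sym _ (p v)) (negPf n1) (eq_sym (q v)) (negPf n2) (eq_sym _ (p v)) (negPf n3).
  rewrite !(nV _ v) (negPf n4) (negPf n5).
  by rewrite (eq_sym _ (q v)) (negPf n6).
apply: (@labeling_of_band G k y) => //.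
- move=> u w; rewrite /y; have := no2 p u w (pp u); have := no2 q u w (qq u).
  by case: (w == p u); case: (u == p w); case: (w == q u); case: (u == q w).
- by move=> u w; rewrite /y; do ![case: ifP => // _].
move=> j /band; have -> // : [set v | \sum_(w | adj v w) y v w <= j] =
    [set v | x v + x (p^-1%g v) + z v + z (q^-1%g v) <= j].
by apply/setP => v; rewrite !inE sumE.
Qed.

(** * Labels for five or six vertices *)

(* [E] lists the edges with label 1, as pairs of indices into [vs]. *)
Lemma labeling_explicit (G : sgraph) (vs : seq G) (x0 : G) (E : seq (nat * nat)) :
    let M i j := ((i, j) \in E) || ((j, i) \in E) in
    let n := size vs in
    regular 4 G -> uniq vs -> n = #|G| ->
    all (fun e => adj (nth x0 vs e.1) (nth x0 vs e.2)) E ->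
    all (fun j => j < count (fun i => count (M i) (iota 0 n) <= j) (iota 0 n) <= j.+2)
        (iota 0 n) ->
  exists lam : labeling 2 G,
    [/\ total_labeling lam, vertex_irregular lam &
        forall w : nat, (exists v : G, wt lam v = w) <-> 5 <= w <= #|G| + 4].
Proof.
move=> M n reg4 un nG /allP adjE /allP band.
pose y u w : nat := M (index u vs) (index w vs).
have mem_vs v : v \in vs.
  have vsG : {subset vs <= enum G} by move=> u _; rewrite mem_enum.
  have [|_ ->] := uniq_min_size un vsG; last exact: mem_enum.
  by rewrite -cardE -nG.
have y_adj u w : 0 < y u w -> adj u w.
  by rewrite /y lt0b => /orP[]/adjE; rewrite /= !nth_index // adj_sym.
have count_vs (P : pred nat) : #|[set v | P (index v vs)]| = count P (iota 0 n).
  have -> : iota 0 n = [seq index v vs | v <- vs].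
    apply: (@eq_from_nth _ 0); rewrite size_iota ?size_map // => i i_n.
    by rewrite nth_iota // (nth_map x0) // index_uniq.
  rewrite count_map -size_filter -(card_uniqP (filter_uniq _ un)).
  by apply: eq_card => v; rewrite !inE mem_filter mem_vs andbT.
have sumE v : \sum_(w | adj v w) y v w = count (M (index v vs)) (iota 0 n).
  rewrite -count_vs -sum1_card (bigID (fun w => M (index v vs) (index w vs))) /=.
  rewrite [X in _ + X]big1 ?addn0; last by move=> w /andP[_]; rewrite /y => /negPf ->.
  apply: eq_big => w; last by move=> /andP[_]; rewrite /y => ->.
  by rewrite inE andbC; apply: andb_idr => Mvw; apply: y_adj; rewrite /y Mvw.
apply: (@labeling_of_band G 1 y) => //.
- by move=> u w; rewrite /y /M orbC.
- by move=> u w; rewrite /y leq_b1.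
move=> j jG; have := band j; rewrite mem_iota add0n nG jG => /(_ isT).
rewrite -nG -count_vs addn1; congr (_ < _ <= _); apply: eq_card => v;
by rewrite !inE sumE.
Qed.

Lemma labeling_small (G : sgraph) : regular 4 G -> 4 < #|G| < 7 ->
  exists lam : labeling 2 G,
    [/\ total_labeling lam, vertex_irregular lam &
        forall w : nat, (exists v : G, wt lam v = w) <-> 5 <= w <= #|G| + 4].
Proof.
move=> reg4 G_small.
have /card_gt0P[a _] : 0 < #|G| by lia.
pose N (v : G) := [set w | adj v w].
have cN v : #|N v| = 4 by rewrite -(reg4 v).
have NE u w : (w \in N u) = adj u w by rewrite inE.
have [G5|G6] : #|G| = 5 \/ #|G| = 6 by lia.
  have adjE (u w : G) : u != w -> adj u w.
    have /setP/(_ w) : N u = [set~ u]; last by rewrite !inE eq_sym => ->.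
    apply/eqP; rewrite eqEcard cN cardsC1 G5 andbT.
    by apply/subsetP => v; rewrite !inE; apply: contraTneq => ->; rewrite adj_irr.
  have sz : size (enum G) = 5 by rewrite -cardE.
  (* In the complete graph these edges give the vertex sums 0, 1, 2, 2, 3. *)
  apply: (@labeling_explicit G (enum G) a [:: (4, 1); (4, 2); (4, 3); (2, 3)]).
  - exact: reg4.
  - exact: enum_uniq.
  - by rewrite sz.
  - apply/allP => e; rewrite !inE => /or4P[] /eqP ->; apply: adjE;
    by rewrite nth_uniq ?enum_uniq ?sz.
  by rewrite sz.
have [c] : exists c, c \in N a by apply/card_gt0P; rewrite cN.
rewrite NE => ac; have : 1 < #|N a :&: N c|.
  by have := cardsUI (N a) (N c); have := max_card (N a :|: N c); rewrite !cN; lia.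
case/card_gt1P => b [b' [+ + bb']]; rewrite !inE => /andP[ab cb] /andP[ab' cb'].
have [c' ] : exists c', c' \in N a :\: [set c; b; b'].
  apply/card_gt0P; have := cardsID [set c; b; b'] (N a).
  have := subset_leq_card (subsetIr (N a) [set c; b; b']).
  have := leq_card_setU [set c; b] [set b']; rewrite cN cards2 cards1 => -[+ _].
  by case: (c != b); lia.
rewrite !inE !negb_or -!andbA => /and4P[c'c c'b c'b' ac'].
have [o] : exists o, o \notin [:: a; c; b; b'; c'].
  apply/existsP; apply: contraT => /existsPn all_in.
  have : #|G| <= size [:: a; c; b; b'; c'].
    apply: leq_trans (card_size _); apply/subset_leq_card/subsetP => v _.
    by rewrite -[_ \in _]negbK.
  by rewrite G6.
rewrite !inE !negb_or => /and5P[oa oc ob ob' oc'].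
have ne (u w : G) : adj u w -> (u == w) = false.
  by move=> uw; apply/negbTE; apply: contraTneq uw => ->; rewrite adj_irr.
(* The star at [a] with the edges from [c] to [b] and [b'] gives the vertex sums 4, 3, 2, 2, 1,
   0. *)
apply: (@labeling_explicit G [:: a; c; b; b'; c'; o] a
  [:: (0, 1); (0, 2); (0, 3); (0, 4); (1, 2); (1, 3)]) => //.
  rewrite /= !inE !(ne _ _ ac) !(ne _ _ ab) !(ne _ _ ab') !(ne _ _ ac') !(ne _ _ cb) !(ne _ _ cb').
  by rewrite !(eq_sym _ c') !(eq_sym _ o) !negb_or bb' c'c c'b c'b' oa oc ob ob' oc'.
by rewrite /= ac ab ab' ac' cb cb'.
Qed.

(** * The strength and the interval of weights *)

Theorem theorem1p3 (G : sgraph) (n s : nat) (hreg : regular 4 G)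
    (hn : #|G| = n) (hs : s = ceil_div (n + 4) 5) :
  tvs G = s /\
  exists lam : labeling s G,
    [/\ total_labeling lam, vertex_irregular lam &
        forall w : nat, (exists v : G, wt lam v = w) <-> 5 <= w <= n + 4].
Proof.
suff lam_ex : exists lam : labeling s G,
    [/\ total_labeling lam, vertex_irregular lam &
        forall w : nat, (exists v : G, wt lam v = w) <-> 5 <= w <= n + 4].
  split=> //; apply/eqP; rewrite eqn_leq; apply/andP; split; last first.
    by rewrite hs -hn; apply: ceil_div_le_tvs.
  have [lam [lam_ok lam_irr _]] := lam_ex.
  rewrite /tvs; case: ex_minnP => m _; apply.
  apply/andP; split; first by rewrite hs /ceil_div; lia.
  by apply/existsP; exists lam; rewrite lam_ok.
(* With [k = s - 1], these two bounds on [s * 5] become [#|G| <= 5 * k + 1] and [5 * k <= #|G| + 3].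
   The empty graph, with [s = 1], is treated apart. *)
subst n; have s_ge : #|G| + 4 <= s * 5 by rewrite -ceil_div_le // hs.
have s_le : s * 5 <= #|G| + 8 by rewrite hs /ceil_div; lia.
have [G0|G_gt0] := posnP #|G|.
  have -> : s = 1 by lia.
  apply: (@labeling_of_band G 0 (fun _ _ => 0)) => // j.
  by rewrite G0.
have G5 : 4 < #|G|.
  have /card_gt0P[v _] := G_gt0; rewrite -(hreg v) -cardsT.
  apply: proper_card; rewrite properE subsetT; apply/subsetPn.
  by exists v; rewrite !inE // adj_irr.
have [G_small|G_large] := ltnP #|G| 7.
  have -> : s = 2 by lia.
  by apply: labeling_small => //; rewrite G5.
have -> : s = s.-1.+1 by lia.
by apply: labeling_large => //; lia.
Qed.
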